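(* Consider the two linear programs (LP-EXT) and (LP-COM) defined in the context, built from the same data $(N,A,D,\Omega,p,c,b,r,q)$. For any feasible solution $(\bar x,\bar\pi)$ of (LP-EXT), there exists a feasible solution of (LP-COM) whose objective value in (LP-COM) is less than or equal to the objective value of $(\bar x,\bar\pi)$ in (LP-EXT). Conversely, for any feasible solution $(\hat x,\hat\pi)$ of (LP-COM), there exists a feasible solution of (LP-EXT) whose objective value in (LP-EXT) is less than or equal to the objective value of $(\hat x,\hat\pi)$ in (LP-COM).
   Context: Data: $(N,A)$ is a finite directed network with node set $N$ and arc set $A\subseteq N\times N$; $D\subseteq A$ is the set of interdictable arcs; $c_a>0$ for $a\in D$; $b>0$ is a budget; $r_a\in(0,1]$ for $a\in A$; $q_a\in[0,r_a)$ for $a\in D$. $\Omega\subseteq N\times N$ is a finite set of origin--destination pairs (scenarios) $\omega=(s,t)$, with probabilities $p_\omega>0$, $\sum_{\omega\in\Omega}p_\omega=1$, and for every $(s,t)\in\Omega$ a directed path from $s$ to $t$ exists. $T=\{t\in N: (s,t)\in\Omega \text{ for some } s\in N\}$ is the set of destinations. For $j\in N$ and $t\in T$, $u_j^t$ is the value of the maximum-reliability path from $j$ to $t$ when no arc is interdicted, i.e. the maximum of $\prod_{a\in P}r_a$ over all simple directed paths $P$ (viewed as sets of arcs) from $j$ to $t$ (the empty path gives $u_t^t=1$; take $u_j^t=0$ if there is no path from $j$ to $t$). For $\omega=(s,t)\in\Omega$, $u_j^\omega=u_j^t$. (LP-EXT), the LP relaxation of the deterministic equivalent formulation, has variables $x\in\mathbb{R}^{D}$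 and $\pi=(\pi_i^\omega)_{i\in N,\omega\in\Omega}$: $$\min \sum_{\omega=(s,t)\in\Omega}p_\omega\pi_s^\omega$$ subject to - $\sum_{a\in D}c_ax_a\le b$; - $\pi_i^\omega-r_a\pi_j^\omega\ge0$ for all $a=(i,j)\in A\setminus D$, $\omega\in\Omega$; - $\pi_i^\omega-r_a\pi_j^\omega\ge-(r_a-q_a)u_j^\omega x_a$ for all $a=(i,j)\in D$, $\omega\in\Omega$; - $\pi_i^\omega-q_a\pi_j^\omega\ge0$ for all $a=(i,j)\in D$, $\omega\in\Omega$; - $\pi_t^\omega=1$ for all $\omega=(s,t)\in\Omega$; - $x_a\in[0,1]$ for all $a\in D$. (LP-COM), the LP relaxation of the compact deterministic equivalent formulation, has variables $x\in\mathbb{R}^{D}$ and $\pi=(\pi_i^t)_{i\in N,t\in T}$: $$\min \sum_{\omega=(s,t)\in\Omega}p_\omega\pi_s^t$$ subject to - $\sum_{a\in D}c_ax_a\le b$; - $\pi_i^t-r_a\pi_j^t\ge0$ for all $a=(i,j)\in A\setminus D$, $t\in T$; - $\pi_i^t-r_a\pi_j^t\ge-(r_a-q_a)u_j^tx_a$ for all $a=(i,j)\in D$, $t\in T$; - $\pi_i^t-q_a\pi_j^t\ge0$ for all $a=(i,j)\in D$, $t\in T$; - $\pi_t^t=1$ for all $t\in T$; - $x_a\in[0,1]$ for all $a\in D$. *)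

(* Defs.v *)
From mathcomp Require Import all_boot all_order all_algebra.
From mathcomp Require Import reals.

Set Implicit Arguments.
Unset Strict Implicit.
Unset Printing Implicit Defensive.

Import Order.TTheory GRing.Theory Num.Theory.
Local Open Scope ring_scope.

(* arcs, iarcs, cost, budget, arel, irel, scen, prob are A, D, c, b, r, q, Omega, p.
   Quantities indexed by a subset (c and q by D, r by A, p by Omega) are total
   functions, constrained and used only on that subset. *)
Record instance (R : realType) (N : finType) := Instance {
  arcs : {set N * N};
  iarcs : {set N * N};
  cost : N * N -> R;
  budget : R;
  arel : N * N -> R;
  irel : N * N -> R;
  scen : {set N * N};
  prob : N * N -> R;
  iarcs_sub : iarcs \subset arcs;
  cost_gt0 : forall a, a \in iarcs -> 0 < cost a;
  budget_gt0 : 0 < budget;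
  arel_range : forall a, a \in arcs -> 0 < arel a <= 1;
  irel_range : forall a, a \in iarcs -> 0 <= irel a < arel a;
  prob_gt0 : forall w, w \in scen -> 0 < prob w;
  prob_sum : \sum_(w in scen) prob w = 1;
  scen_connect : forall s t, (s, t) \in scen ->
    connect (fun i j => (i, j) \in arcs) s t
}.

Section Programs.
Variables (R : realType) (N : finType) (I : instance R N).

Definition dests : {set N} := [set t | [exists s, (s, t) \in scen I]].

(* The path j = v_0, v_1, ..., v_k is given by its tail v = [:: v_1; ...; v_k]. *)
Definition simple_path (j t : N) (v : seq N) : bool :=
  [&& path (fun i k => (i, k) \in arcs I) j v, last j v == t & uniq (j :: v)].

Definition path_rel (j : N) (v : seq N) : R :=
  \prod_(a <- pairmap pair j v) arel I a.

(* A simple path has fewer than #|N| arcs, so the ranges below cover all of them;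
   path reliabilities are positive, so the default 0 is taken exactly when there
   is no path from j to t. *)
Definition max_rel (j t : N) : R :=
  \big[Num.max/0]_(k < #|N|)
    \big[Num.max/0]_(v : k.-tuple N | simple_path j t v) path_rel j v.

(* In both programs, the entries of x outside D, and those of pi whose second
   index is outside Omega (resp. T), are neither constrained nor used. *)
Record ext_feasible (x : N * N -> R) (pi : N -> N * N -> R) : Prop := {
  ext_budget : \sum_(a in iarcs I) cost I a * x a <= budget I;
  ext_arc : forall i j w, (i, j) \in arcs I :\: iarcs I -> w \in scen I ->
    pi i w - arel I (i, j) * pi j w >= 0;
  ext_iarc : forall i j w, (i, j) \in iarcs I -> w \in scen I ->
    pi i w - arel I (i, j) * pi j w
      >= - ((arel I (i, j) - irel I (i, j)) * max_rel j w.2 * x (i, j));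
  ext_iarc_irel : forall i j w, (i, j) \in iarcs I -> w \in scen I ->
    pi i w - irel I (i, j) * pi j w >= 0;
  ext_dest : forall s t, (s, t) \in scen I -> pi t (s, t) = 1;
  ext_x : forall a, a \in iarcs I -> 0 <= x a <= 1
}.

Definition ext_obj (pi : N -> N * N -> R) : R :=
  \sum_(w in scen I) prob I w * pi w.1 w.

Record com_feasible (x : N * N -> R) (pi : N -> N -> R) : Prop := {
  com_budget : \sum_(a in iarcs I) cost I a * x a <= budget I;
  com_arc : forall i j t, (i, j) \in arcs I :\: iarcs I -> t \in dests ->
    pi i t - arel I (i, j) * pi j t >= 0;
  com_iarc : forall i j t, (i, j) \in iarcs I -> t \in dests ->
    pi i t - arel I (i, j) * pi j t
      >= - ((arel I (i, j) - irel I (i, j)) * max_rel j t * x (i, j));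
  com_iarc_irel : forall i j t, (i, j) \in iarcs I -> t \in dests ->
    pi i t - irel I (i, j) * pi j t >= 0;
  com_dest : forall t, t \in dests -> pi t t = 1;
  com_x : forall a, a \in iarcs I -> 0 <= x a <= 1
}.

Definition com_obj (pi : N -> N -> R) : R :=
  \sum_(w in scen I) prob I w * pi w.1 w.2.

End Programs.

(* Main.v *)
(** Both directions keep [x]. Scenarios with the same destination [t] have the
    same constraints, of the form [pi_i >= r * pi_j - K] with [r >= 0]; these are
    preserved by the pointwise minimum over such scenarios, which can only lower
    the objective. Conversely, a compact solution is copied to every scenario. *)
Require Import Defs.
From mathcomp Require Import all_boot all_order all_algebra.
From mathcomp Require Import reals.
Import Order.TTheory GRing.Theory Num.Theory.
Local Open Scope ring_scope.

Section MinimumOverOrigins.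
Variables (R : realType) (N : finType) (I : instance R N).
Implicit Types (pi : N -> N * N -> R) (i j s t : N).

Lemma scen_dests s t : (s, t) \in scen I -> t \in dests I.
Proof. by move=> st; rewrite inE; apply/existsP; exists s. Qed.

(* The value [0] is only taken for [t] outside [dests I]. *)
Definition min_pi pi i t : R :=
  if [pick s | (s, t) \in scen I] is Some s0
  then pi i ([arg min_(s < s0 | (s, t) \in scen I) pi i (s, t)]%O, t)
  else 0.

(** The minimizing origin [s] may vary with the node [i]. *)
Lemma min_pi_attained pi i t : t \in dests I ->
  exists2 s, (s, t) \in scen I & min_pi pi i t = pi i (s, t).
Proof.
rewrite inE /min_pi => /existsP[s st].
case: pickP => [s0 s0t|/(_ s)]; last by rewrite st.
by case: arg_minP => // s1 s1t _; exists s1.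
Qed.

Lemma min_pi_le pi i s t : (s, t) \in scen I -> min_pi pi i t <= pi i (s, t).
Proof.
move=> st; rewrite /min_pi; case: pickP => [s0 s0t|/(_ s)]; last by rewrite st.
by case: arg_minP => // s1 _; apply.
Qed.

(** At an origin [s] minimizing at [i], the first term is exactly [pi i (s, t)], while
    [min_pi pi j t <= pi j (s, t)] and [0 <= r] only shrink what is subtracted. The bound [K] has to
    be the same for all origins. *)
Lemma min_pi_superharmonic pi i j t (r K : R) : 0 <= r -> t \in dests I ->
  (forall s, (s, t) \in scen I -> K <= pi i (s, t) - r * pi j (s, t)) ->
  K <= min_pi pi i t - r * min_pi pi j t.
Proof.
move=> r0 tT piK; have [s st ->] := min_pi_attained pi i t tT.
by apply: le_trans (piK s st) _; rewrite lerD2l lerN2 ler_wpM2l ?min_pi_le.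
Qed.

Lemma min_pi_feasible x pi :
  ext_feasible I x pi -> com_feasible I x (min_pi pi).
Proof.
move=> [bx arc iarc iarcq dest xr].
have r0 a : a \in arcs I -> 0 <= arel I a.
  by move=> /arel_range/andP[/ltW].
split=> //.
- move=> i j t ijA tT; apply: min_pi_superharmonic => // [|s st]; last exact: arc.
  by apply: r0; case/setDP: ijA.
- move=> i j t ijD tT; apply: min_pi_superharmonic => // [|s st].
    by apply: r0; apply: subsetP ijD; exact: iarcs_sub.
  (* The right-hand side depends on the scenario only through its destination, so it serves as a
     common [K]. *)
  exact: (iarc i j (s, t)).
- move=> i j t ijD tT; apply: min_pi_superharmonic => // [|s st]; last exact: iarcq.
  by have /andP[] := irel_range ijD.
(* The minimum at [t] is an attained value, and all these values are 1. *)
- by move=> t tT; have [s st ->] := min_pi_attained pi t t tT; apply: dest.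
Qed.

Lemma min_pi_obj pi : com_obj I (min_pi pi) <= ext_obj I pi.
Proof.
apply: ler_sum => -[s t] st.
by rewrite ler_wpM2l ?min_pi_le // ltW // prob_gt0.
Qed.

Lemma com_feasible_ext x (pi : N -> N -> R) :
  com_feasible I x pi -> ext_feasible I x (fun i w => pi i w.2).
Proof.
move=> [bx arc iarc iarcq dest xr]; split=> //.
- by move=> i j [s t] ijA /scen_dests; apply: arc.
- by move=> i j [s t] ijD /scen_dests; apply: iarc.
- by move=> i j [s t] ijD /scen_dests; apply: iarcq.
- by move=> s t /scen_dests; apply: dest.
Qed.

End MinimumOverOrigins.

Theorem proposition1 (R : realType) (N : finType) (I : instance R N) :
  (forall (x : N * N -> R) (pi : N -> N * N -> R), ext_feasible I x pi ->
     exists (x' : N * N -> R) (pi' : N -> N -> R),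
       com_feasible I x' pi' /\ com_obj I pi' <= ext_obj I pi) /\
  (forall (x : N * N -> R) (pi : N -> N -> R), com_feasible I x pi ->
     exists (x' : N * N -> R) (pi' : N -> N * N -> R),
       ext_feasible I x' pi' /\ ext_obj I pi' <= com_obj I pi).
Proof.
split=> x pi feas.
  exists x, (min_pi R N I pi).
  by split; [exact: min_pi_feasible | exact: min_pi_obj].
(* The two objectives coincide by computation here, so reflexivity closes the inequality. *)
by exists x, (fun i w => pi i w.2); split; [exact: com_feasible_ext |].
Qed.
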